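(* Any relation between elements in the generating set $\{J_1,J_2,\dots,J_n\}$ of the monoid $\mathcal{I}$ is a consequence of the following relations: (a) $J_i^2=J_i$ for all $i$; (b) $J_iJ_j=J_jJ_i$ if there is no arrow between $i$ and $j$; (c) $J_jJ_iJ_j=J_iJ_jJ_i=J_jJ_i$ if there is an arrow $i\to j$.
   Context: $\Bbbk$ is an algebraically closed field. $Q$ is an oriented connected tree with vertex set $Q_0=\{1,2,\dots,n\}$, $n>1$. $\mathbf{K}(Q)$ is the set of all vertices that are sinks or sources, and $\mathbf{K}'(Q)$ is the set of all $i\in\mathbf{K}(Q)$ with $\deg_Q(i)\geq 2$. $Q$ is assumed to be admissible: every vertex of degree at least $3$ belongs to $\mathbf{K}(Q)$. It is also assumed that $\mathbf{K}'(Q)\neq\varnothing$ (equivalently, $Q$ is not isomorphic to $1\to 2\to\dots\to m$). $A$ is the path algebra of $Q$ over $\Bbbk$, with trivial paths $e_i$; if there is an oriented path from $i$ to $j$, the unique such path is denoted $\mathtt{a}_{ji}$ and spans $e_jAe_i$ (so left modules are used and $\mathtt{a}_{kj}\mathtt{a}_{ji}=\mathtt{a}_{ki}$). $\mathcal{I}$ is the monoid of all two-sided ideals of $A$ under multiplication of ideals, with identity $A$. $J_i$ is the ideal spanned by all paths $\mathtt{a}_{ts}$ other than $\mathtt{a}_{ii}=e_i$, i.e. the kernel of the canonical bimodule epimorphism $A\to L_{ii}=L_i\otimes_{\Bbbk}L_i^*$, where $L_i$ is the simple module at $i$. The elements $J_1,\dots,J_n$ generate $\mathcal{I}$ and satisfy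 the relations (a)--(c). ''Any relation is a consequence of'' these relations means that the canonical surjection from the abstract monoid with generators $J_1,\dots,J_n$ and defining relations (a)--(c) onto $\mathcal{I}$ is an isomorphism. *)

(* Defs.v *)
From HB Require Import structures.
From mathcomp Require Import all_boot all_order all_algebra all_field.

Set Implicit Arguments.
Unset Strict Implicit.
Unset Printing Implicit Defensive.

Import GRing.Theory.
Local Open Scope ring_scope.

(* There is at most one arrow between two vertices of a tree, so the arrows
   form a relation.  [arrow_asym] excludes both loops (take i = j) and pairs of
   opposite arrows, i.e. multiple edges of the underlying graph, which would
   not be seen by [tree_acyclic]. *)
Record oriented_tree (n : nat) := OrientedTree {
  arrow : rel 'I_n;
  tree_nonempty : (0 < n)%N;
  arrow_asym : forall i j, arrow i j -> ~~ arrow j i;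
  tree_connected :
    forall i j, connect (fun i j => arrow i j || arrow j i) i j;
  tree_acyclic :
    forall c : seq 'I_n, (2 < size c)%N ->
      ~ ucycle (fun i j => arrow i j || arrow j i) c
}.

Section Tree.
Variables (n : nat) (Q : oriented_tree n).
Implicit Types i j : 'I_n.

Definition adjacent : rel 'I_n := fun i j => arrow Q i j || arrow Q j i.

Definition degree i : nat := #|[set j | adjacent i j]|.
Definition is_sink i : bool := [forall j, ~~ arrow Q i j].
Definition is_source i : bool := [forall j, ~~ arrow Q j i].

Definition sinks_and_sources : {set 'I_n} := [set i | is_sink i || is_source i].
Definition inner_sinks_and_sources : {set 'I_n} :=
  [set i in sinks_and_sources | (2 <= degree i)%N].

Definition admissible : Prop :=
  forall i, (3 <= degree i)%N -> i \in sinks_and_sources.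

(* An oriented path i_0 -> i_1 -> ... -> i_m is the pair (i_0, [i_1; ...; i_m]);
   the trivial path at i is (i, [::]). *)
Definition qpath := {p : 'I_n * seq 'I_n | path (arrow Q) p.1 p.2}.

Definition path_source (p : qpath) : 'I_n := (val p).1.
Definition path_target (p : qpath) : 'I_n := last (val p).1 (val p).2.

Definition trivial_path i : qpath := Sub (i, [::]) isT.

(* r is the path "q followed by p". *)
Definition is_composite (p q r : qpath) : bool :=
  (path_target q == path_source p) &&
  (val r == (path_source q, (val q).2 ++ (val p).2)).

Lemma path_uniq_tree x s : path (arrow Q) x s -> uniq (x :: s).
Proof.
elim: s x => // y s IHs x /andP[xy ys].
rewrite cons_uniq (IHs _ ys) andbT; apply/negP=> xin.
have {IHs} ys' : path (arrow Q) y s by [].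
case/splitPl: xin ys' => s1 s2 lst; rewrite cat_path => /andP[ys1 _].
case/shortenP: ys1 lst => p ysp up _ lst.
have cyc : cycle (arrow Q) (y :: p) by rewrite /= rcons_path ysp lst xy.
case: p ysp up lst cyc => [|z p] ysp up lst cyc.
  by move: cyc; rewrite /= andbT => yy; move: (arrow_asym yy); rewrite yy.
case: p ysp up lst cyc => [|t p] ysp up lst cyc.
  move: ysp => /=; rewrite andbT => yz.
  by move: cyc; rewrite /= yz /= andbT (negbTE (arrow_asym yz)).
case: (@tree_acyclic _ Q [:: y, z, t & p] isT).
rewrite /ucycle up andbT; apply: sub_path cyc => a b.
by move=> ->.
Qed.

Lemma size_path_tree (p : qpath) : (size (val p).2 <= n)%N.
Proof.
case: p => [[x s] /= xs]; have us := path_uniq_tree xs.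
have := max_card (mem (x :: s)); rewrite (card_uniqP us) card_ord.
exact: ltnW.
Qed.

Definition qpath_code (p : qpath) : 'I_n * n.-bseq 'I_n :=
  ((val p).1, Bseq (size_path_tree p)).
Definition qpath_decode (c : 'I_n * n.-bseq 'I_n) : option qpath :=
  insub (c.1, val c.2).
Lemma qpath_codeK : pcancel qpath_code qpath_decode.
Proof.
move=> p; rewrite /qpath_decode /qpath_code /=.
by rewrite -surjective_pairing valK.
Qed.

HB.instance Definition _ := Countable.on qpath.
HB.instance Definition _ : isFinite qpath := PCanIsFinite qpath_codeK.

End Tree.

Section PathAlgebra.
Variables (k : fieldType) (n : nat) (Q : oriented_tree n).

(* A function f stands for the linear combination of the paths p with
   coefficients f p. *)
Definition path_algebra : Type := {ffun qpath Q -> k^o}.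

HB.instance Definition _ := Vector.on path_algebra.

Implicit Types (x y z : path_algebra) (p q r s : qpath Q).

(* Basis paths multiply like maps: p * q is "q followed by p". *)
Definition pa_mul x y : path_algebra :=
  [ffun r => \sum_p \sum_(q | is_composite p q r) (x p : k) * y q].

Definition pa_one : path_algebra :=
  [ffun p : qpath Q => ((val p).2 == [::])%:R].

Lemma pa_mulE x y r :
  pa_mul x y r = \sum_p \sum_q (x p : k) * y q * (is_composite p q r)%:R.
Proof.
rewrite ffunE; apply: eq_bigr => p _; rewrite big_mkcond /=.
by apply: eq_bigr => q _; case: ifP; rewrite ?mulr1 ?mulr0.
Qed.

Definition comp3 p q r s : bool :=
  [&& path_target q == path_source p, path_target r == path_source q
    & val s == (path_source r, (val r).2 ++ (val q).2 ++ (val p).2)].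

Lemma composite_exists p q :
  path_target q == path_source p -> exists r, is_composite p q r.
Proof.
case: p q => [[a s] /= as_] [[b t] /= bt_]; rewrite /path_target /path_source /=.
move=> e.
have pth : path (arrow Q) b (t ++ s) by rewrite cat_path bt_ (eqP e).
by exists (Sub (b, t ++ s) pth); rewrite /is_composite /path_target /path_source /= e eqxx.
Qed.

Lemma composite_src p q r : is_composite p q r -> path_source r = path_source q.
Proof. by case/andP=> _ /eqP e; rewrite /path_source e. Qed.

Lemma composite_tgt p q r : is_composite p q r -> path_target r = path_target p.
Proof.
case/andP=> /eqP tq /eqP e; rewrite /path_target e /= last_cat.
by move: tq; rewrite /path_target /path_source => ->.
Qed.

Lemma composite_inj p q r r' :
  is_composite p q r -> is_composite p q r' -> r = r'.
Proof. by case/andP=> _ /eqP e /andP[_ /eqP e']; apply: val_inj; rewrite e e'. Qed.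

Lemma composite_sum p q (P : pred (qpath Q)) :
  \sum_r ((is_composite p q r)%:R * (P r)%:R) =
  ([exists r, is_composite p q r && P r])%:R :> k.
Proof.
case: existsP => [[r /andP[c Pr]]|no].
  rewrite (bigD1 r) //= c Pr mulr1 big1 ?addr0 // => r' ne.
  case c' : (is_composite p q r'); last by rewrite mul0r.
  by rewrite (composite_inj c c') eqxx in ne.
rewrite big1 // => r _; case c : (is_composite p q r); last by rewrite mul0r.
by case Pr : (P r); rewrite ?mulr0 //; case: no; exists r; rewrite c Pr.
Qed.

Lemma comp3l p q r s :
  [exists t, is_composite p q t && is_composite t r s] = comp3 p q r s.
Proof.
apply/existsP/idP => [[t /andP[c1 c2]]|/and3P[e1 e2 e3]].
  have:= composite_src c1; move: c1 c2 => /andP[e1 /eqP e2] /andP[e3 e4] e5.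
  by rewrite /comp3 e1 -e5 e3 (eqP e4) e2 /= eqxx.
have [t c1] := composite_exists e1; exists t; rewrite c1 /is_composite.
rewrite (composite_src c1) e2 (eqP e3) /=.
by case/andP: c1 => _ /eqP -> /=; rewrite eqxx.
Qed.

Lemma comp3r p q r s :
  [exists t, is_composite q r t && is_composite p t s] = comp3 p q r s.
Proof.
apply/existsP/idP => [[t /andP[c1 c2]]|/and3P[e1 e2 e3]].
  have:= composite_tgt c1; have:= composite_src c1.
  move: c1 c2 => /andP[e1 /eqP e2] /andP[e3 e4] e5 e6.
  by rewrite /comp3 e1 -e6 e3 (eqP e4) e2 e5 /= catA eqxx.
have [t c1] := composite_exists e2; exists t; rewrite c1 /is_composite.
rewrite (composite_tgt c1) (composite_src c1) e1 (eqP e3) /=.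
by case/andP: c1 => _ /eqP -> /=; rewrite catA eqxx.
Qed.

Lemma pa_mulA : associative pa_mul.
Proof.
move=> x y z; apply/ffunP=> s; rewrite !pa_mulE.
transitivity (\sum_p \sum_q \sum_r
    (x p : k) * y q * z r * (comp3 p q r s)%:R).
  apply: eq_bigr => p _.
  transitivity (\sum_t \sum_q \sum_r (x p : k) * y q * z r *
      ((is_composite q r t)%:R * (is_composite p t s)%:R)).
    apply: eq_bigr => t _; rewrite pa_mulE mulr_sumr mulr_suml.
    apply: eq_bigr => q _; rewrite mulr_sumr mulr_suml.
    by apply: eq_bigr => r _; rewrite !mulrA.
  rewrite exchange_big; apply: eq_bigr => q _; rewrite exchange_big.
  by apply: eq_bigr => r _; rewrite -mulr_sumr composite_sum comp3r.
symmetry.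
transitivity (\sum_t \sum_r \sum_p \sum_q (x p : k) * y q * z r *
    ((is_composite p q t)%:R * (is_composite t r s)%:R)).
  apply: eq_bigr => t _; apply: eq_bigr => r _.
  rewrite pa_mulE !mulr_suml; apply: eq_bigr => p _.
  rewrite !mulr_suml; apply: eq_bigr => q _.
  by rewrite -!mulrA; do 2!congr (_ * _); rewrite mulrCA.
rewrite exchange_big /=.
transitivity (\sum_r \sum_p \sum_q (x p : k) * y q * z r * (comp3 p q r s)%:R).
  apply: eq_bigr => r _; rewrite exchange_big; apply: eq_bigr => p _.
  rewrite exchange_big; apply: eq_bigr => q _.
  by rewrite -mulr_sumr composite_sum comp3l.
rewrite exchange_big; apply: eq_bigr => p _; exact: exchange_big.
Qed.

Lemma composite1l p q r :
  (val p).2 = [::] -> is_composite p q r -> q = r /\ p = trivial_path Q (path_target r).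
Proof.
case: p => [[a s] /= as_] /= e; subst s => c; have:= composite_tgt c.
case/andP: c => t /eqP e e'; split.
  by apply: val_inj; rewrite e /= cats0 /path_source -surjective_pairing.
by apply: val_inj => /=; rewrite e'.
Qed.

Lemma composite1r p q r :
  (val q).2 = [::] -> is_composite p q r -> p = r /\ q = trivial_path Q (path_source r).
Proof.
case: q => [[a s] /= as_] /= e; subst s => c; have:= composite_src c.
case/andP: c => /eqP t /eqP e e'; split.
  apply: val_inj; rewrite e /= (_ : path_source _ = path_source p) //.
  by rewrite /path_source -surjective_pairing.
by apply: val_inj => /=; rewrite e'.
Qed.

Lemma composite_triv_l r : is_composite (trivial_path Q (path_target r)) r r.
Proof.
by rewrite /is_composite {2}/path_source /= eqxx cats0 /path_source -surjective_pairing eqxx.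
Qed.

Lemma composite_triv_r r : is_composite r (trivial_path Q (path_source r)) r.
Proof.
by rewrite /is_composite {1}/path_target /path_source /= eqxx -surjective_pairing eqxx.
Qed.

Lemma pa_mul1l : left_id pa_one pa_mul.
Proof.
move=> x; apply/ffunP=> r; rewrite pa_mulE.
rewrite (bigD1 (trivial_path Q (path_target r))) //= (bigD1 r) //=.
rewrite ffunE /= composite_triv_l mul1r mulr1 !big1 ?addr0 // => [p ne|q ne].
  rewrite big1 // => q _; rewrite ffunE.
  case: eqP => [e|_]; last by rewrite !mul0r.
  case c : is_composite; last by rewrite mulr0.
  by move: ne; rewrite (composite1l e c).2 eqxx.
case c : is_composite; last by rewrite mulr0.
by move: ne; rewrite (composite1l _ c).1 ?eqxx.
Qed.

Lemma pa_mul1r : right_id pa_one pa_mul.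
Proof.
move=> x; apply/ffunP=> r; rewrite pa_mulE exchange_big.
rewrite (bigD1 (trivial_path Q (path_source r))) //= (bigD1 r) //=.
rewrite ffunE /= composite_triv_r !mulr1 !big1 ?addr0 // => [q ne|p ne].
  rewrite big1 // => p _; rewrite ffunE.
  case: eqP => [e|_]; last by rewrite mulr0 mul0r.
  case c : is_composite; last by rewrite mulr0.
  by move: ne; rewrite (composite1r e c).2 eqxx.
case c : is_composite; last by rewrite mulr0.
by move: ne; rewrite (composite1r _ c).1 ?eqxx.
Qed.

Lemma pa_mulDl : left_distributive pa_mul +%R.
Proof.
move=> x y z; apply/ffunP=> r; rewrite [RHS]ffunE !pa_mulE -big_split /=.
apply: eq_bigr => p _; rewrite -big_split /=; apply: eq_bigr => q _.
by rewrite ffunE !mulrDl.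
Qed.

Lemma pa_mulDr : right_distributive pa_mul +%R.
Proof.
move=> x y z; apply/ffunP=> r; rewrite [RHS]ffunE !pa_mulE -big_split /=.
apply: eq_bigr => p _; rewrite -big_split /=; apply: eq_bigr => q _.
by rewrite ffunE mulrDr mulrDl.
Qed.

Lemma pa_one_neq0 : pa_one != 0.
Proof.
apply/eqP=> /ffunP/(_ (trivial_path Q (Ordinal (tree_nonempty Q)))).
by rewrite !ffunE => /eqP; rewrite oner_eq0.
Qed.

HB.instance Definition _ := GRing.Zmodule_isNzRing.Build path_algebra
  pa_mulA pa_mul1l pa_mul1r pa_mulDl pa_mulDr pa_one_neq0.

Lemma pa_scaleAl (a : k) x y : a *: (x * y) = (a *: x) * y.
Proof.
apply/ffunP=> r; rewrite [LHS]ffunE !pa_mulE scaler_sumr; apply: eq_bigr => p _.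
rewrite scaler_sumr; apply: eq_bigr => q _; rewrite ffunE.
by rewrite /GRing.scale /= !mulrA.
Qed.

Lemma pa_scaleAr (a : k) x y : a *: (x * y) = x * (a *: y).
Proof.
apply/ffunP=> r; rewrite [LHS]ffunE !pa_mulE scaler_sumr; apply: eq_bigr => p _.
rewrite scaler_sumr; apply: eq_bigr => q _; rewrite ffunE.
by rewrite /GRing.scale /= !mulrA; congr (_ * _ * _); rewrite mulrC.
Qed.

HB.instance Definition _ :=
  GRing.Lmodule_isLalgebra.Build k path_algebra pa_scaleAl.
HB.instance Definition _ :=
  GRing.Lalgebra_isAlgebra.Build k path_algebra pa_scaleAr.
HB.instance Definition _ := Algebra_isFalgebra.Build k path_algebra.

Definition path_vector (p : qpath Q) : path_algebra :=
  [ffun q => (q == p)%:R].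

End PathAlgebra.

Section Ideals.
Variables (k : fieldType) (A : falgType k).

(* Since A is unital, two-sided ideals are automatically linear subspaces. *)
Definition is_ideal (I : {vspace A}) : bool :=
  (fullv * I <= I)%VS && (I * fullv <= I)%VS.

Definition ideal := {I : {vspace A} | is_ideal I}.

HB.instance Definition _ := Choice.on ideal.

Lemma ideal_mul_subproof (I J : ideal) : is_ideal (val I * val J)%VS.
Proof.
case: I J => [I /= /andP[Il Ir]] [J /= /andP[Jl Jr]].
by rewrite /is_ideal prodvA -(prodvA I J) prodvSl // prodvSr.
Qed.

Definition ideal_mul (I J : ideal) : ideal := Sub _ (ideal_mul_subproof I J).

Lemma ideal_one_subproof : is_ideal fullv.
Proof. by rewrite /is_ideal !subvf. Qed.

Definition ideal_one : ideal := Sub fullv ideal_one_subproof.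

Lemma ideal_mulA : associative ideal_mul.
Proof. by move=> I J K; apply: val_inj; rewrite /= prodvA. Qed.

Lemma ideal_mul1l : left_id ideal_one ideal_mul.
Proof.
case=> [I idI]; apply: val_inj => /=; case/andP: (idI) => Il _.
apply/eqP; rewrite eqEsubv Il -{1}[I]prod1v prodvSl //; exact: subvf.
Qed.

Lemma ideal_mul1r : right_id ideal_one ideal_mul.
Proof.
case=> [I idI]; apply: val_inj => /=; case/andP: (idI) => _ Ir.
apply/eqP; rewrite eqEsubv Ir -{1}[I]prodv1 prodvSr //; exact: subvf.
Qed.

HB.instance Definition _ :=
  isMonoid.Build ideal ideal_mulA ideal_mul1l ideal_mul1r.

End Ideals.

Section Generators.
Variables (k : fieldType) (n : nat) (Q : oriented_tree n).

Local Notation A := (path_algebra k Q).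

Definition J_space (i : 'I_n) : {vspace A} :=
  <<[seq path_vector k p | p in predC1 (trivial_path Q i)]>>%VS.

Lemma mem_J_space i (x : A) : (x \in J_space i) = (x (trivial_path Q i) == 0).
Proof.
apply/idP/eqP => [|x0].
  move=> /coord_span ->; rewrite sum_ffunE big1 // => j _; rewrite ffunE.
  set X := image_tuple _ _.
  have: X`_j \in tval X by apply: mem_nth; rewrite size_tuple.
  case/imageP=> p ne ->.
  by rewrite ffunE eq_sym (negbTE ne) scaler0.
have -> : x = \sum_p x p *: path_vector k p.
  apply/ffunP=> q; rewrite sum_ffunE (bigD1 q) //= big1 => [|p ne].
    by rewrite !ffunE eqxx addr0 /GRing.scale /= mulr1.
  by rewrite !ffunE eq_sym (negbTE ne) scaler0.
apply: memv_suml => p _; have [->|ne] := eqVneq p (trivial_path Q i).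
  by rewrite x0 scale0r mem0v.
apply: memvZ; apply: memv_span.
exact: image_f.
Qed.

Lemma composite_trivial (p q : qpath Q) i :
  is_composite p q (trivial_path Q i) ->
  p = trivial_path Q i /\ q = trivial_path Q i.
Proof.
move=> c; have /andP[_ /eqP[_ e]] := c.
have [/eqP eq0 /eqP ep0] : nilp (val q).2 /\ nilp (val p).2.
  by move/(congr1 size): e; rewrite size_cat /nilp /= => /esym/eqP;
    rewrite addn_eq0 => /andP.
by split; [have [] := composite1r (size0nil eq0) c
          | have [] := composite1l (size0nil ep0) c].
Qed.

Lemma J_subproof i : is_ideal (J_space i).
Proof.
rewrite /is_ideal; apply/andP; split; apply/prodvP => x y;
  rewrite !mem_J_space => xJ yJ; apply/eqP; rewrite ffunE;
  apply: big1 => p _; apply: big1 => q /composite_trivial[-> ->].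
  by rewrite (eqP yJ) mulr0.
by rewrite (eqP xJ) mul0r.
Qed.

Definition J (i : 'I_n) : ideal A := Sub (J_space i) (J_subproof i).

End Generators.

(* The monoid with generators X and defining relations R is the quotient of the
   free monoid [seq X] by this congruence. *)
Inductive word_congruence (X : Type) (R : seq X -> seq X -> Prop) :
  seq X -> seq X -> Prop :=
| wc_rel u v : R u v -> word_congruence R u v
| wc_refl u : word_congruence R u u
| wc_sym u v : word_congruence R u v -> word_congruence R v u
| wc_trans u v w :
    word_congruence R u v -> word_congruence R v w -> word_congruence R u w
| wc_cat u u' v v' : word_congruence R u v -> word_congruence R u' v' ->
    word_congruence R (u ++ u') (v ++ v').

(* The canonical map from the monoid <X | R> to M is an isomorphism: it is onto,
   well defined (<-) and injective (->). *)
Definition presented_by (X : Type) (M : monoidType) (g : X -> M)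
    (R : seq X -> seq X -> Prop) : Prop :=
  (forall m : M, exists w : seq X, \big[*%g/1%g]_(x <- w) g x = m) /\
  (forall u v : seq X,
     \big[*%g/1%g]_(x <- u) g x = \big[*%g/1%g]_(x <- v) g x
     <-> word_congruence R u v).

Inductive J_relation (n : nat) (Q : oriented_tree n) :
  seq 'I_n -> seq 'I_n -> Prop :=
| J_idem i : J_relation Q [:: i; i] [:: i]
| J_comm i j : ~~ adjacent Q i j -> J_relation Q [:: i; j] [:: j; i]
| J_arrow_jij i j : arrow Q i j -> J_relation Q [:: j; i; j] [:: j; i]
| J_arrow_iji i j : arrow Q i j -> J_relation Q [:: i; j; i] [:: j; i].

(* Main.v *)
(** Every ideal of A is spanned by the paths it contains, because a tree has at
    most one path between two vertices.  A path p lies outside the product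
    J_(w_1) ... J_(w_r) iff the sequence of vertices of p is a subsequence of
    the reversed word w_r ... w_1.  So the theorem is about words and the
    oriented paths which are subsequences of them.

    Injectivity: in a shortest word of a congruence class, between two
    consecutive occurrences of x there are both an in- and an out-neighbour of
    x, since otherwise the relations delete one of the two x.  If two shortest
    words x u and v have the same paths, then no letter before the first x of v
    is adjacent to x, so x can be moved to the front of v, and the paths of
    the remaining words again coincide.

    Surjectivity: for a set D of paths closed under subpaths, the relation "the
    first z must precede the first x" orients some edges of the tree, hence has
    a minimal element x; then D is the path set of a word x w, where the path
    set of w is obtained from D by removing some paths that start at x.
    Admissibility enters here: an interior vertex of an oriented path has only
    one in-neighbour. *)

Require Import Defs.
From mathcomp Require Import all_boot all_order all_algebra all_field.
From Stdlib Require Import Classical.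

Set Implicit Arguments.
Unset Strict Implicit.
Unset Printing Implicit Defensive.

Import GRing.Theory.

(** * Subsequences and first occurrences *)

Lemma subseq_rcons2 (T : eqType) (s w : seq T) x y :
  subseq (rcons s y) (rcons w x) =
  if y == x then subseq s w else subseq (rcons s y) w.
Proof.
rewrite -[LHS]subseq_rev !rev_rcons /=; case: eqP => _; first exact: subseq_rev.
by rewrite -rev_rcons subseq_rev.
Qed.

Lemma subseq_cons_cat (T : eqType) x (s w1 w2 : seq T) :
  x \notin w1 -> subseq (x :: s) (w1 ++ x :: w2) = subseq s w2.
Proof.
elim: w1 => [|y w1 IHw] /=; first by rewrite eqxx.
by rewrite inE negb_or => /andP[/negbTE -> /IHw].
Qed.

Lemma split_first (T : eqType) x (w : seq T) : x \in w ->
  exists w1 w2, w = w1 ++ x :: w2 /\ x \notin w1.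
Proof.
elim: w => // y w IHw; rewrite inE.
case: eqVneq => [<- _|xy /= /IHw[w1 [w2 [-> nx]]]]; first by exists [::], w.
by exists (y :: w1), w2; rewrite inE negb_or xy.
Qed.

Lemma subseq_cat_split (T : eqType) (s w1 w2 : seq T) : subseq s (w1 ++ w2) ->
  exists s1 s2, [/\ s = s1 ++ s2, subseq s1 w1 & subseq s2 w2].
Proof.
elim: w1 s => [|x w1 IHw] s; first by exists [::], s.
case: s => [_|y s]; first by exists [::], [::]; rewrite !sub0seq.
rewrite cat_cons /=; case: eqP => [->|yx] /IHw[s1 [s2 [e ss1 ss2]]].
  by exists (x :: s1), s2; rewrite e /= eqxx.
case: s1 e ss1 => [|z s1] e ss1; first by exists [::], s2.
exists (z :: s1), s2; split=> //; exact: subseq_trans ss1 (subseq_cons _ _).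
Qed.

(** * Words modulo the relations *)

Section Words.
Variables (n : nat) (Q : oriented_tree n).
Implicit Types (x y z : 'I_n) (s t u v w : seq 'I_n).

(* Paths compose from right to left in A but vertices are listed from source to
   target, whence the reversal. *)
Definition rcong u v := word_congruence (J_relation Q) (rev u) (rev v).

Lemma rcong_refl u : rcong u u. Proof. exact: wc_refl. Qed.

Lemma rcong_sym u v : rcong u v -> rcong v u.
Proof. exact: (@wc_sym _ _ (rev u)). Qed.

Lemma rcong_trans u v w : rcong u v -> rcong v w -> rcong u w.
Proof. exact: (@wc_trans _ _ _ (rev v)). Qed.

Lemma rcong_cat u u' v v' :
  rcong u v -> rcong u' v' -> rcong (u ++ u') (v ++ v').
Proof. by move=> uv uv'; rewrite /rcong !rev_cat; apply: wc_cat. Qed.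

Lemma rcong_catl u v v' : rcong v v' -> rcong (u ++ v) (u ++ v').
Proof. exact/rcong_cat/rcong_refl. Qed.

Lemma rcong_catr v u u' : rcong u u' -> rcong (u ++ v) (u' ++ v).
Proof. by move=> uu'; apply: rcong_cat uu' (rcong_refl v). Qed.

Lemma rcong_idem x : rcong [:: x; x] [:: x].
Proof. exact/wc_rel/J_idem. Qed.

Lemma rcong_comm x y : ~~ adjacent Q x y -> rcong [:: x; y] [:: y; x].
Proof. by move=> nxy; apply/wc_rel/J_comm; rewrite /adjacent orbC. Qed.

(** For [x -> y] this is a case of (c); otherwise [x] and [y] are not adjacent, and commuting them
    leaves an instance of (a). *)
Lemma rcong_absorb_right x y : ~~ arrow Q y x -> rcong [:: x; y; x] [:: x; y].
Proof.
move=> nyx; case xy: (arrow Q x y); first exact/wc_rel/J_arrow_iji.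
apply: rcong_trans (rcong_catr [:: y] (rcong_idem x)).
by apply/(@rcong_catl [:: x])/rcong_comm; rewrite /adjacent xy (negbTE nyx).
Qed.

Lemma rcong_absorb_left x y : ~~ arrow Q x y -> rcong [:: x; y; x] [:: y; x].
Proof.
move=> nxy; case yx: (arrow Q y x); first exact/wc_rel/J_arrow_jij.
apply: rcong_trans (rcong_catl [:: y] (rcong_idem x)).
apply: (@rcong_catr [:: x] [:: x; y] [:: y; x]); apply: rcong_comm.
by rewrite /adjacent yx (negbTE nxy).
Qed.

(** A copy of [x] can be inserted behind a letter that has no arrow to [x]. So an [x] travels
    through [u], absorbs the last [x], and is taken out again on the way back. *)
Lemma rcong_del_last x u :
  ~~ has (fun y => arrow Q y x) u -> rcong (x :: rcons u x) (x :: u).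
Proof.
elim: u => [|y u IHu] /=; first by move=> _; apply: rcong_idem.
rewrite negb_or => /andP[/rcong_absorb_right/rcong_sym xy /IHu{}IHu].
apply: rcong_trans (rcong_catr (rcons u x) xy) _.
apply: rcong_trans (rcong_catl [:: x; y] IHu) _.
exact: (rcong_catr u (rcong_sym xy)).
Qed.

Lemma rcong_del_first x u :
  ~~ has (arrow Q x) u -> rcong (x :: rcons u x) (rcons u x).
Proof.
elim/last_ind: u => [|u y IHu] /=; first by move=> _; apply: rcong_idem.
rewrite has_rcons negb_or => /andP[/rcong_absorb_left xy /IHu{}IHu].
rewrite -!cats1 -!catA /= -[x :: u ++ _]/((x :: u) ++ [:: y; x]).
apply: rcong_trans (rcong_catl (x :: u) (rcong_sym xy)) _.
rewrite -(cat1s x [:: y; x]) catA cats1 /=.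
by apply: rcong_trans (rcong_catr _ IHu) _; rewrite -cats1 -catA;
  apply: rcong_catl.
Qed.

Lemma rcong_move_front x u w :
  ~~ has (adjacent Q x) u -> rcong (u ++ x :: w) (x :: u ++ w).
Proof.
elim: u => [|y u IHu] /=; first by move=> _; apply: rcong_refl.
rewrite negb_or => /andP[xy /IHu{}IHu].
apply: rcong_trans (rcong_catl [:: y] IHu) _.
exact: (rcong_catr (u ++ w) (rcong_sym (rcong_comm xy))).
Qed.

(** * Shortest words *)

Definition shortest w := forall v, rcong v w -> size w <= size v.

Lemma exists_shortest w : exists2 v, rcong v w & shortest v.
Proof.
have [m le_wm] := ubnP (size w); elim: m w le_wm => // m IHm w le_wm.
(* Congruence of words is not known to be decidable at this point, hence the excluded middle. *)
have [[v [vw lt_vw]]|no] := classic (exists v, rcong v w /\ size v < size w).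
  have [v' v'v sv'] := IHm v (leq_trans lt_vw le_wm).
  by exists v' => //; apply: rcong_trans v'v vw.
exists w; first exact: rcong_refl.
by move=> v vw; rewrite leqNgt; apply/negP=> lt_vw; apply: no; exists v.
Qed.

Lemma shortest_rcong u v :
  rcong u v -> size u = size v -> shortest v -> shortest u.
Proof.
by move=> uv suv sv t tu; rewrite suv; apply: sv; apply: rcong_trans tu uv.
Qed.

Lemma shortest_suffix u v : shortest (u ++ v) -> shortest v.
Proof.
by move=> suv t /(rcong_catl u)/suv; rewrite !size_cat leq_add2l.
Qed.

Lemma shortest_gap u x v w : shortest (u ++ x :: v ++ x :: w) ->
  has (fun y => arrow Q y x) v /\ has (arrow Q x) v.
Proof.
move=> suw; split; apply: contraT.
  move/rcong_del_last/(rcong_catr w)/(rcong_catl u)/rcong_sym/(rcong_trans _).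
  rewrite /= -cats1 -catA /= => /(_ _ (rcong_refl _))/suw.
  by rewrite !size_cat /= !size_cat /= leq_add2l !ltnS addnS ltnn.
move/rcong_del_first/(rcong_catr w)/(rcong_catl u)/rcong_sym/(rcong_trans _).
rewrite /= -cats1 -catA /= => /(_ _ (rcong_refl _))/suw.
by rewrite !size_cat /= !size_cat /= leq_add2l ltnn.
Qed.

Lemma arrow_neq x y : arrow Q x y -> (y == x) = false.
Proof.
by move=> xy; apply/eqP=> yx; subst y; have:= arrow_asym xy; rewrite xy.
Qed.

(* The witness is built from the left: a second occurrence of x in w leaves an
   out-neighbour of x in between, from which one goes on. *)
Lemma shortest_lost_path x w : shortest (x :: w) ->
  exists s, [/\ path (arrow Q) x s, subseq s w & ~~ subseq (x :: s) w].
Proof.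
have [m le_wm] := ubnP (size w); elim: m x w le_wm => // m IHm x w le_wm sxw.
have [/split_first[w1 [w2 [wE nx1]]]|nx] := boolP (x \in w); last first.
  by exists [::]; rewrite sub0seq sub1seq.
subst w; have [_ /hasP[z /splitPr zw1 xz]] := @shortest_gap [::] x w1 w2 sxw.
case: w1 / zw1 nx1 sxw le_wm => w11 w12 nx1 sxw le_wm.
have{sxw}: shortest ((x :: w11) ++ z :: (w12 ++ x :: w2)).
  by move: sxw; rewrite -catA.
move/shortest_suffix/IHm => [|s [zs ss nss]].
  move: le_wm; rewrite -catA size_cat /=.
  by rewrite addnS ltnS => /(leq_ltn_trans (leq_addl _ _)).
exists (z :: s); rewrite /= xz zs; split=> //.
  by rewrite -catA -[z :: s]cat0s cat_subseq ?sub0seq //= eqxx.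
(* The first [x] of [w] comes after this [z], so [x :: z :: s] inside [w] would put [z :: s] behind
   this [z], where it is lost. *)
rewrite subseq_cons_cat //; apply: contra nss => ss2.
by apply: subseq_trans ss2 _; rewrite -cat_rcons suffix_subseq.
Qed.

(** * Oriented paths contained in a word *)

Definition same_paths u v :=
  forall p, sorted (arrow Q) p -> subseq p u = subseq p v.

Lemma same_paths_cat u u' v v' :
  same_paths u v -> same_paths u' v' -> same_paths (u ++ u') (v ++ v').
Proof.
move=> uv uv' p sp; apply/idP/idP => /subseq_cat_split[s1 [s2 [pE ss1 ss2]]];
  move: sp; rewrite pE => /cat_sorted2[sp1 sp2]; apply: cat_subseq.
- by rewrite -uv.
- by rewrite -uv'.
- by rewrite uv.
- by rewrite uv'.
Qed.

Lemma same_paths_rel u v : J_relation Q u v -> same_paths (rev u) (rev v).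
Proof.
have asym x y : arrow Q x y -> arrow Q y x = false.
  by move=> xy; apply/negbTE/arrow_asym.
have irr x : arrow Q x x = false.
  by apply/negP=> xx; have:= asym _ _ xx; rewrite xx.
(* Both sides have at most three letters, so the first three vertices of the path and the equalities
   among the letters decide everything; what remains contradicts asymmetry or non-adjacency. *)
case=> [x|x y|x y xy|x y xy] => [|nxy||] [|a [|b [|c p]]] //=;
  rewrite /rev /= ?andbT //;
  repeat (match goal with |- context [@eq_op _ ?a ?b] => is_var a; is_var b;
    case: (a =P b) => ?; subst; rewrite //= ?irr // end).
- by move=> yx; move: nxy; rewrite /adjacent yx orbT.
- by move=> xy; move: nxy; rewrite /adjacent xy.
- by rewrite asym.
- by rewrite asym.
- by rewrite asym.
- by rewrite (asym _ _ xy) andbF.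
Qed.

Lemma rcong_same_paths u v : rcong u v -> same_paths u v.
Proof.
rewrite -{2}[u]revK -{2}[v]revK /rcong.
elim=> {u v} [u v|u|u v _ IH|u v w _ IH1 _ IH2|u u' v v' _ IH _ IH'] //.
- exact: same_paths_rel.
- by move=> p sp; rewrite IH.
- by move=> p sp; rewrite IH1 ?IH2.
- by rewrite !rev_cat; apply: same_paths_cat.
Qed.

(** A path from [x] inside [u] uses a second occurrence of [x], and the gap before it contains an
    in-neighbour [y]. The path extended by [y] cannot use the prepended [x], so it survives in
    [v]. *)
Lemma shortest_behead_paths x u v s :
    shortest (x :: u) ->
    (forall p, sorted (arrow Q) p -> subseq p (x :: u) -> subseq p (x :: v)) ->
  path (arrow Q) x s -> subseq (x :: s) u -> subseq (x :: s) v.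
Proof.
move=> sxu uv xs ss; have /split_first[w1 [w2 [uE nx]]] : x \in u.
  by rewrite -sub1seq; apply: subseq_trans ss; rewrite sub1seq mem_head.
subst u; have [/hasP[y yw1 yx] _] := @shortest_gap [::] x w1 w2 sxu.
suffices: subseq (y :: x :: s) (x :: v).
  by rewrite /= eq_sym (arrow_neq yx); apply: cons_subseq.
apply: uv; first by rewrite /= yx.
rewrite /= eq_sym (arrow_neq yx) -[y :: _]/([:: y] ++ x :: s).
by rewrite cat_subseq ?sub1seq //= eqxx -(subseq_cons_cat _ _ nx).
Qed.

Lemma shortest_same_paths u v :
  shortest u -> shortest v -> same_paths u v -> rcong u v.
Proof.
elim: u v => [|x u IHu] v su sv uv.
  case: v sv uv => [|y v] _ uv; first exact: rcong_refl.
  by have := uv [:: y] isT; rewrite /= eqxx sub0seq.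
have /split_first[v1 [v2 [vE nx]]] : x \in v.
  by rewrite -sub1seq -uv ?sub1seq ?mem_head.
have nadj: ~~ has (adjacent Q x) v1.
  apply/hasPn=> y yv1; apply/negP=> /orP[xy|yx].
    (* Case [x -> y]: some path [y :: s] is lost when this [y] is removed from its suffix of [v].
       But [x :: y :: s] lies in [x :: u], hence in [v], which puts [y :: s] behind the first
       [x]. *)
    have [p1 [p2 v1E]] : exists p1 p2, v1 = p1 ++ y :: p2.
      by case/splitPr: yv1 => p1 p2; exists p1, p2.
    have vE': v = p1 ++ y :: (p2 ++ x :: v2) by rewrite vE v1E -catA.
    have := sv; rewrite vE' => /shortest_suffix/shortest_lost_path[s [ys ss /negP]].
    apply; have: subseq (y :: s) (x :: u).
      rewrite uv // vE' -[y :: s]cat0s cat_subseq ?sub0seq //=; by rewrite eqxx.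
    rewrite /= (arrow_neq xy) => ss'.
    have: subseq (x :: y :: s) (x :: u) by rewrite /= eqxx.
    rewrite uv /= ?xy // vE subseq_cons_cat // => ss2.
    by apply: subseq_trans ss2 _; rewrite -cat_rcons suffix_subseq.
  (* Case [y -> x]: some path [x :: s] lies in [x :: u] but not in [u]. In [v] it can be extended by
     the earlier [y], and [y :: x :: s] in [x :: u] must avoid the first letter. *)
  have [s [xs ss /negP]] := shortest_lost_path su; apply.
  have: subseq (x :: s) (x :: u) by rewrite /= eqxx.
  rewrite uv // vE subseq_cons_cat // => ss2.
  have: subseq (y :: x :: s) v.
    by rewrite vE -[y :: _]/([:: y] ++ x :: s) cat_subseq ?sub1seq //= eqxx.
  by rewrite -uv /= ?yx // eq_sym (arrow_neq yx); apply: cons_subseq.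
have vv' : rcong v (x :: v1 ++ v2) by rewrite vE; apply: rcong_move_front.
have sv' : shortest (x :: v1 ++ v2).
  apply: shortest_rcong (rcong_sym vv') _ sv.
  by rewrite vE /= !size_cat /= addnS.
have uv' : same_paths (x :: u) (x :: v1 ++ v2).
  by move=> p sp; rewrite uv // (rcong_same_paths vv').
apply: rcong_trans (rcong_sym vv'); apply: (@rcong_catl [:: x]).
apply: IHu; [exact: (@shortest_suffix [:: x])|exact: (@shortest_suffix [:: x])|].
case=> [|y s] ys; first by rewrite !sub0seq.
have [yx|yx] := eqVneq y x; last by have := uv' _ ys; rewrite /= (negbTE yx).
rewrite yx in ys *; apply/idP/idP; apply: shortest_behead_paths => // p sp.
  by rewrite uv'.
by rewrite uv'.
Qed.

Lemma same_paths_rcong u v : same_paths u v -> rcong u v.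
Proof.
move=> uv; have [u' uu' su'] := exists_shortest u.
have [v' vv' sv'] := exists_shortest v.
apply: rcong_trans (rcong_sym uu') _; apply: (rcong_trans _ vv').
apply: shortest_same_paths => // p sp.
by rewrite (rcong_same_paths uu') // uv // (rcong_same_paths vv').
Qed.

(** * Unique paths and minimal vertices in the tree *)

Lemma path_unique x s t : path (arrow Q) x s -> path (arrow Q) x t ->
  last x s = last x t -> s = t.
Proof.
elim: s x t => [|y s IHs] x [|z t] //.
- move=> _ xt e; have := path_uniq_tree xt.
  by rewrite /= in e; rewrite cons_uniq {1}e mem_last.
- move=> xs _ e; have := path_uniq_tree xs.
  by rewrite /= in e; rewrite cons_uniq -{1}e mem_last.
move=> xs xt e; case/andP: (xs) (xt) => xy ys /andP[xz zt].
have [yz|yz] := eqVneq y z; first by subst z; rewrite (IHs y t).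
have : has (mem (z :: t)) (y :: s).
  apply/hasP; exists (last y s); first exact: mem_last.
  by rewrite (e : last y s = last z t) /= mem_last.
move eS: (y :: s) xs => S xs hS.
(* [m] is the first vertex of [y :: s] that lies on [z :: t]; out along [s1] to [m] and back along
   [t1] is then a cycle of the tree. *)
case: (split_find hS) xs eS => m s1 s2 mt hs1 xs eS.
move eT: (z :: t) xt mt hs1 => T xt mt hs1.
have [t1 [t2 TE]] : exists t1 t2, T = t1 ++ m :: t2.
  by case/splitPr: mt => t1 t2; exists t1, t2.
have := path_uniq_tree xs; have := path_uniq_tree xt.
move: xt xs; rewrite TE -cat_rcons !cat_path => /andP[xt _] /andP[xs _].
rewrite /= !mem_cat !cat_uniq !mem_rcons !rcons_uniq !inE !negb_or -!andbA.
case/and5P=> xm xt1 _ mt1 /andP[ut1 _] /and5P[_ xs1 _ ms1 /andP[us1 _]].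
have cyc : ucycle (fun i j => arrow Q i j || arrow Q j i) (x :: s1 ++ m :: rev t1).
  apply/andP; split.
    rewrite /= -cats1 -catA /= cats1 -rev_cons -cat_rcons cat_path last_rcons.
    rewrite (sub_path _ xs) => [|i j ->] //=.
    have := rev_path (fun i j => arrow Q i j || arrow Q j i) x (rcons t1 m).
    rewrite last_rcons belast_rcons => ->.
    by apply: sub_path xt => i j ->; rewrite orbT.
  rewrite cons_uniq cat_uniq cons_uniq mem_cat inE !mem_rev rev_uniq.
  rewrite us1 ut1 mt1 (negbTE xm) (negbTE xs1) (negbTE xt1) /= andbT.
  rewrite negb_or ms1 /=; apply/hasPn=> i; rewrite mem_rev => it1.
  by apply: contra hs1 => is1; apply/hasP; exists i => //; rewrite /= TE mem_cat it1.
case: (@tree_acyclic _ Q (x :: s1 ++ m :: rev t1)) => //=.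
rewrite size_cat /= size_rev addnS !ltnS.
(* Two empty arcs would give [y = m = z], so the cycle has at least three vertices. *)
case: s1 t1 TE eS {xs xs1 ms1 us1 hs1 cyc xt xt1 mt1 ut1} => [|? ?] [|? ?] //=.
by rewrite -eT => -[zm _] [ym _]; rewrite zm ym eqxx in yz.
Qed.

(** Otherwise iterated choice of a [B]-smaller vertex runs into a loop. Asymmetry of [B] excludes
    loops with one or two vertices, and longer ones are cycles of the tree. *)
Lemma tree_minimal (P : pred 'I_n) (B : rel 'I_n) x0 : P x0 ->
    subrel B (adjacent Q) -> (forall x y, B x y -> ~~ B y x) ->
  exists2 x, P x & forall z, P z -> ~~ B z x.
Proof.
move=> Px0 sBQ asymB.
case: (pickP (fun x => P x && [forall z, P z ==> ~~ B z x])).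
  move=> x /andP[Px /forallP xmin]; exists x => // z Pz.
  exact: (implyP (xmin z)).
(* By [nomin] the default value [x] never occurs at a vertex satisfying [P]. *)
move=> nomin; pose f x := odflt x [pick z | P z && B z x].
have fP x : P x -> P (f x) /\ B (f x) x.
  move=> Px; rewrite /f; case: pickP => [z /andP[]|noz] //.
  case/negP: (nomin x); rewrite Px; apply/forallP=> z; apply/implyP=> Pz.
  by have:= noz z; rewrite Pz /= => ->.
have iterP m : P (iter m f x0) by elim: m => //= m /fP[].
have trajectP' x m : P x -> all P (traject f x m).
  by elim: m x => //= m IHm x Px; rewrite Px IHm //; have [] := fP x.
have /trajectP[m lt_mo /= loop] := looping_order f x0.
set y := iter m f x0 in loop; have Py : P y := iterP m.
have [l oE] : exists l, order f x0 = m + l.+1.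
  by exists (order f x0 - m.+1); rewrite addnS -addSn subnKC.
have yl : iter l.+1 f y = y by rewrite -iterD addnC -oE loop.
have uc : uniq (traject f y l.+1).
  have := orbit_uniq f x0; rewrite /orbit oE trajectD cat_uniq.
  by case/and3P.
case: (@tree_acyclic _ Q (traject f y l.+1)).
  case: l {oE uc} yl => [|[|l]] /= yl; last by rewrite size_traject.
    by have [_] := fP y Py; rewrite yl => Byy; have := asymB _ _ Byy; rewrite Byy.
  have [Pfy Bfy] := fP y Py; have [_] := fP _ Pfy.
  by rewrite yl (negbTE (asymB _ _ Bfy)).
rewrite /ucycle uc andbT /=.
have := fpath_traject f y l.+1; rewrite trajectSr -iterSr yl.
apply: (@sub_in_path _ P) => [a b|].
  move=> Pa _ /eqP <-; have [_ /sBQ] := fP a Pa.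
  by rewrite /adjacent orbC.
by rewrite /= all_rcons Py trajectP' //; have [] := fP y Py.
Qed.

(** * Words for path sets closed under subpaths *)

Hypothesis Q_admissible : admissible Q.

(** Such an [x] is neither a sink nor a source, so a third neighbour would violate admissibility. *)
Lemma through_degree2 x y z (t : 'I_n) : arrow Q y x -> arrow Q x z -> adjacent Q x t ->
  t \in [:: y; z].
Proof.
move=> yx xz xt; apply: contraT; rewrite !inE negb_or => /andP[ty tz].
have yz : y != z.
  by apply/eqP=> yz; have := arrow_asym yx; rewrite yz xz.
have : x \in sinks_and_sources Q.
  apply: Q_admissible; rewrite /degree; apply: leq_trans (_ : 3 <= #|t |: [set y; z]|) _.
    by rewrite cardsU1 cards2 !inE negb_or ty tz yz.
  apply/subset_leq_card/subsetP=> a; rewrite !inE => /or3P[] /eqP-> //.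
    by rewrite /adjacent yx orbT.
  by rewrite /adjacent xz.
rewrite inE => /orP[/forallP/(_ z)|/forallP/(_ y)]; first by rewrite xz.
by rewrite yx.
Qed.

Lemma pred_unique x y y' z : arrow Q y x -> arrow Q y' x -> arrow Q x z -> y = y'.
Proof.
move=> yx y'x xz; have := @through_degree2 x y z y' yx xz.
rewrite /adjacent y'x orbT !inE => /(_ isT)/orP[/eqP //|/eqP y'z].
by have := arrow_asym y'x; rewrite y'z xz.
Qed.

Section Closed.
Variable D : 'I_n -> seq 'I_n -> bool.
Hypothesis D_path : forall x s, D x s -> path (arrow Q) x s.
Hypothesis D_prefix : forall x s t, D x (s ++ t) -> D x s.

(* [precedes z x]: in a word with path set D, the first z precedes the first x. *)
Definition precedes z x :=
  [exists p : qpath Q,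
    [&& arrow Q x z, (val p).1 == z, D z (val p).2 & ~~ D x (z :: (val p).2)]] ||
  arrow Q z x &&
  [forall p : qpath Q, (((val p).1 == x) && D x (val p).2) ==> D z (x :: (val p).2)].

Lemma precedes_adjacent : subrel precedes (adjacent Q).
Proof.
move=> z x /orP[/existsP[p /and4P[xz _ _ _]]|/andP[zx _]]; rewrite /adjacent.
  by rewrite xz orbT.
by rewrite zx.
Qed.

(** By asymmetry of the arrows the two directions would use different clauses for the same arrow:
    one gives a path of [D] from its head that does not extend along the arrow, the other says that
    all of them do. *)
Lemma precedes_asym x z : precedes x z -> ~~ precedes z x.
Proof.
have excl y (t : 'I_n) :
    [exists p : qpath Q,
      [&& arrow Q y t, (val p).1 == t, D t (val p).2 & ~~ D y (t :: (val p).2)]] ->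
    [forall p : qpath Q, (((val p).1 == t) && D t (val p).2) ==> D y (t :: (val p).2)] ->
    False.
  move=> /existsP[p /and4P[_ pt Dt nD]] /forallP/(_ p).
  by rewrite pt Dt (negbTE nD).
move=> xz; apply/negP=> zx; case/orP: xz => [/[dup] ex /existsP[p /and4P[zx' _ _ _]]|].
  case/orP: zx => [/existsP[q /and4P[xz' _ _ _]]|/andP[_ all]].
    by have := arrow_asym zx'; rewrite xz'.
  exact: (excl z x).
case/andP=> xz all; case/orP: zx => [ex|/andP[zx' _]]; first exact: (excl x z).
by have := arrow_asym xz; rewrite zx'.
Qed.

(** Such an [x] can serve as first letter: the first property says that prepending it creates no
    path outside [D], the second that fewer paths remain to be realised. *)
Lemma exists_first x0 s0 : D x0 s0 -> exists x,
  (forall z s, arrow Q x z -> D z s -> D x (z :: s)) /\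
  (exists2 s, D x s & forall y, ~~ D y (x :: s)).
Proof.
have D0 x s : D x s -> D x [::] by apply: (@D_prefix x [::]).
have DP x s : D x s -> exists p : qpath Q, val p = (x, s).
  by move=> Dxs; exists (Sub (x, s) (D_path Dxs)); rewrite SubK.
have Darrow x y s : D y (x :: s) -> arrow Q y x by case/D_path/andP.
move/D0/(@tree_minimal (fun x => D x [::]))/(_ precedes_adjacent precedes_asym).
case=> x Dx xmin; exists x; split=> [z s xz Dz|].
  apply: contraT => nD; have [p pE] := DP _ _ Dz.
  case/negP: (xmin z (D0 _ _ Dz)); apply/orP; left; apply/existsP; exists p.
  by rewrite pE /= xz Dz nD eqxx.
have lost y : arrow Q y x -> exists2 s, D x s & ~~ D y (x :: s).
  move=> yx; have [Dy|nDy] := boolP (D y [::]); last first.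
    by exists [::] => //; apply: contra nDy; apply: D0.
  have := xmin y Dy; rewrite negb_or yx /= => /andP[_].
  rewrite negb_forall => /existsP[p]; rewrite negb_imply => /andP[/andP[_ Ds] nD].
  by exists (val p).2.
have [y /= yx|nox] := pickP (fun y => arrow Q y x); last first.
  by exists [::] => // y; apply/negP=> /Darrow; rewrite nox.
(* One path must work against all in-neighbours. If it or the path lost for [y'] is nontrivial, [x]
   also has an out-neighbour and its in-neighbour is unique; otherwise both are the trivial path. *)
have [s Ds nD] := lost y yx; exists s => // y'; apply/negP=> D'.
have y'x := Darrow _ _ _ D'.
case: s Ds nD D' => [|z s] Ds nD D'; last first.
  have xz := Darrow _ _ _ Ds.
  by rewrite (pred_unique yx y'x xz) D' in nD.
have [[|z s] Ds' nD'] := lost y' y'x; first by rewrite D' in nD'.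
by rewrite (pred_unique yx y'x (Darrow _ _ _ Ds')) D' in nD.
Qed.

End Closed.

(* D is turned into the path set of x :: w by removing those paths from x which
   must use the prepended letter, i.e. which do not extend to the left in D. *)
Lemma closed_paths_word (D : 'I_n -> seq 'I_n -> bool) :
    (forall x s, D x s -> path (arrow Q) x s) ->
    (forall x s t, D x (s ++ t) -> D x s) ->
    (forall x y s, D x (y :: s) -> D y s) ->
  exists w, forall x s, path (arrow Q) x s -> D x s = subseq (x :: s) w.
Proof.
have [m] := ubnP #|[set p : qpath Q | D (val p).1 (val p).2]|.
elim: m D => // m IHm D ltm Dpath Dpre Dsuf.
have [p Dp|noD] := pickP (fun p : qpath Q => D (val p).1 (val p).2); last first.
  by exists [::] => x s xs; have := noD (Sub (x, s) xs); rewrite SubK.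
have [x [xfirst [s Dxs nDs]]] := exists_first Dpath Dpre Dp.
pose D' y t := D y t && ((y != x) || [exists y', D y' (x :: t)]).
have D'D y t : D' y t -> D y t by case/andP.
have [||||w wE] := IHm D'.
- rewrite -ltnS; apply: leq_trans ltm; rewrite ltnS; apply: proper_card.
  rewrite properE; apply/andP; split.
    by apply/subsetP=> q; rewrite !inE; apply: D'D.
  apply/negP=> /subsetP/(_ (Sub (x, s) (Dpath _ _ Dxs))).
  rewrite !inE SubK /D' Dxs eqxx /= => /(_ isT)/existsP[y].
  by rewrite (negbTE (nDs y)).
- by move=> y t /D'D/Dpath.
- move=> y t t' /andP[/Dpre Dyt]; rewrite /D' Dyt /=.
  case: eqP => //= _ /existsP[y' Dy']; apply/existsP; exists y'.
  exact: (Dpre _ (x :: t) t').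
- move=> y z t /D'D Dyzt; rewrite /D' (Dsuf _ _ _ Dyzt) /=.
  by case: eqP => //= <-; apply/existsP; exists y.
exists (x :: w) => y t yt; rewrite /=; case: (eqVneq y x) => [yx|yx]; last first.
  by rewrite -wE // /D' yx /= andbT.
subst y; case: t yt => [|z t]; first by rewrite sub0seq => _; apply: (Dpre _ [::]) Dxs.
move=> /andP[xz zt]; rewrite -wE // /D' (arrow_neq xz) /= andbT.
by apply/idP/idP => [/Dsuf //|]; apply: xfirst.
Qed.

End Words.

(** * Ideals and their path components *)

Section Algebra.
Local Open Scope ring_scope.
Variables (k : fieldType) (n : nat) (Q : oriented_tree n).
Local Notation A := (path_algebra k Q).
Local Notation pv := (@path_vector k n Q).

Lemma path_vector_mul (p q r : qpath Q) : is_composite p q r -> pv p * pv q = pv r.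
Proof.
move=> c; apply/ffunP=> s; rewrite [LHS]pa_mulE.
rewrite (bigD1 p) //= (bigD1 q) //= !ffunE !eqxx !mul1r !big1 ?addr0.
- have [->|sr] := eqVneq s r; first by rewrite c.
  by case c' : is_composite => //; rewrite (composite_inj c c') eqxx in sr.
- by move=> p' pp'; rewrite big1 // => q' _; rewrite !ffunE (negbTE pp') !mul0r.
- by move=> q' qq'; rewrite !ffunE (negbTE qq') mulr0 mul0r.
Qed.

Lemma path_vector_mul0 (p q : qpath Q) :
  path_target q != path_source p -> pv p * pv q = 0.
Proof.
move=> npq; apply/ffunP=> s; rewrite [LHS]pa_mulE ffunE.
apply: big1 => p' _; apply: big1 => q' _; rewrite !ffunE.
have [->|_] := eqVneq p' p; last by rewrite !mul0r.
have [->|_] := eqVneq q' q; last by rewrite mulr0 mul0r.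
by rewrite /is_composite (negbTE npq) mulr0.
Qed.

Lemma path_vector_sum (a : A) : a = \sum_p (a p : k) *: pv p.
Proof.
apply/ffunP=> q; rewrite sum_ffunE (bigD1 q) //= big1 => [|p ne].
  by rewrite !ffunE eqxx addr0 /GRing.scale /= mulr1.
by rewrite !ffunE eq_sym (negbTE ne) scaler0.
Qed.

Lemma qpath_unique (p q : qpath Q) : path_source p = path_source q ->
  path_target p = path_target q -> p = q.
Proof.
case: p q => [[x s] /= xs] [[y t] /= yt]; rewrite /path_source /path_target /=.
move=> xy; subst y => e; apply: val_inj => /=.
by rewrite (path_unique xs yt e).
Qed.

(** Multiplying by trivial paths on both sides keeps only the paths with the ends of [p], and in a
    tree [p] is the only one. *)
Lemma path_component (a : A) (p : qpath Q) :
  pv (trivial_path Q (path_target p)) * a * pv (trivial_path Q (path_source p)) =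
  (a p : k) *: pv p.
Proof.
rewrite [a in LHS]path_vector_sum mulr_sumr mulr_suml (bigD1 p) //= big1 ?addr0.
  rewrite -scalerAr -scalerAl (path_vector_mul (composite_triv_l p)).
  by rewrite (path_vector_mul (composite_triv_r p)).
move=> q qp; rewrite -scalerAr -scalerAl.
have [tq|tq] := eqVneq (path_target q) (path_target p); last first.
  by rewrite (path_vector_mul0 (p := trivial_path Q _) tq) mul0r scaler0.
rewrite -tq (path_vector_mul (composite_triv_l q)).
rewrite path_vector_mul0 ?scaler0 //; apply: contra qp => /eqP sq.
by apply/eqP/qpath_unique.
Qed.

Lemma ideal_mull (I : ideal A) a b : b \in val I -> a * b \in val I.
Proof.
case: I => [I /= /andP[/subvP Il _]] bI; apply: Il.
by rewrite memv_mul ?memvf.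
Qed.

Lemma ideal_mulr (I : ideal A) a b : a \in val I -> a * b \in val I.
Proof.
case: I => [I /= /andP[_ /subvP Ir]] aI; apply: Ir.
by rewrite memv_mul ?memvf.
Qed.

Lemma mem_ideal (I : ideal A) a :
  (a \in val I) = [forall p, (a p == 0) || (pv p \in val I)].
Proof.
apply/idP/forallP=> [aI p|aI].
  have [//|ap /=] := eqVneq (a p) 0.
  have: (a p : k) *: pv p \in val I by rewrite -path_component ideal_mulr ?ideal_mull.
  by rewrite -[pv p in X in _ -> X]scale1r -(mulVf ap) -scalerA; apply: memvZ.
rewrite (path_vector_sum a); apply: memv_suml => p _.
by case/orP: (aI p) => [/eqP->|pI]; rewrite ?scale0r ?mem0v ?memvZ.
Qed.

(** * Paths in products of the generators *)

Definition vertices (p : qpath Q) : seq 'I_n := (val p).1 :: (val p).2.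

Local Notation prodJ w := (\big[*%g/1%g]_(x <- w) J k Q x).

Lemma mem_span_path_vectors (S : pred (qpath Q)) a :
  (a \in <<[seq pv p | p in S]>>%VS) = [forall p, (a p == 0) || S p].
Proof.
apply/idP/forallP => [|aS].
  move=> /coord_span -> p; rewrite orbC; case Sp: (S p) => //=.
  rewrite sum_ffunE big1 // => j _; rewrite ffunE.
  set X := image_tuple _ _.
  have: X`_j \in tval X by apply: mem_nth; rewrite size_tuple.
  case/imageP=> q Sq ->; rewrite ffunE; case: eqP => [pq|_]; last exact: scaler0.
  by have := Sq : S q; rewrite -pq Sp.
rewrite (path_vector_sum a); apply: memv_suml => p _.
case/orP: (aS p) => [/eqP->|Sp]; first by rewrite scale0r mem0v.
by apply/memvZ/memv_span/image_f.
Qed.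

Lemma trivial_path_inj x y : trivial_path Q x = trivial_path Q y -> x = y.
Proof. by case. Qed.

Lemma path_vector_J x (p : qpath Q) :
  (pv p \in J_space k Q x) = (p != trivial_path Q x).
Proof.
rewrite mem_J_space ffunE (eq_sym _ p); case: (p == _); last by rewrite eqxx.
exact/negbTE/oner_neq0.
Qed.

Lemma path_vector_prodJ w p :
  (pv p \in val (prodJ w)) = ~~ subseq (vertices p) (rev w).
Proof.
elim: w p => [|x w IHw] p; first by rewrite big_nil memvf.
rewrite big_cons rev_cons; apply/idP/idP => [pJ|].
  (* The coefficient of [p] vanishes on the whole product: whenever [p] is [p1] after [p2] and [p1]
     is not the trivial path at [x], the vertices of [p2] still form a subsequence of [rev w]. *)
  pose S : pred (qpath Q) := predC1 p.
  apply/negP=> sp; suffices: pv p \in <<[seq pv q | q in S]>>%VS.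
    rewrite mem_span_path_vectors => /forallP/(_ p).
    by rewrite ffunE /S /= eqxx oner_eq0.
  apply: subvP pJ; apply/prodvP=> a b.
  rewrite mem_J_space mem_ideal => /eqP ax /forallP bw.
  rewrite mem_span_path_vectors; apply/forallP=> r; rewrite /S /= orbC.
  have [->|//] := eqVneq r p; rewrite /= pa_mulE; apply/eqP.
  apply: big1 => p1 _; apply: big1 => p2 _.
  have [c|] := boolP (is_composite p1 p2 p); last by rewrite mulr0.
  have [p1x|p1x] := eqVneq p1 (trivial_path Q x); first by rewrite p1x ax !mul0r.
  case/orP: (bw p2) => [/eqP->|]; first by rewrite mulr0 mul0r.
  rewrite IHw => /negP[].
  have [p1nil|] := eqVneq (val p1).2 [::].
    have [-> p1E] := composite1l p1nil c; move: sp.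
    rewrite /vertices lastI subseq_rcons2 -lastI; case: eqP => // tx.
    by rewrite p1E /path_target tx eqxx in p1x.
  have : vertices p = vertices p2 ++ (val p1).2.
    by case/andP: c => _ /eqP; rewrite /vertices => ->.
  case: (val p1).2 => // z s pE _; move: sp; rewrite pE lastI -rcons_cat subseq_rcons2.
  by case: ifP => _ /(subseq_trans _); apply; rewrite ?rcons_cat prefix_subseq.
(* Conversely a left factor in [J_x] is split off from [p]: the trivial path at its end if that is
   not [x], and its last arrow otherwise. *)
case: p => [[y s] ys]; rewrite /vertices /=; case/lastP: s ys => [|s z] ys nsub.
  rewrite -(path_vector_mul (composite_triv_l _)); apply: memv_mul.
    rewrite path_vector_J; apply: contra nsub => /eqP/trivial_path_inj <-.
    by rewrite sub1seq mem_rcons mem_head.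
  rewrite IHw; apply: contra nsub => /subseq_trans; apply; exact: subseq_rcons.
have [zx|zx] := eqVneq z x; last first.
  rewrite -(path_vector_mul (composite_triv_l _)); apply: memv_mul.
    rewrite path_vector_J; apply: contra zx => /eqP/trivial_path_inj <-.
    by rewrite /path_target /= last_rcons.
  rewrite IHw; apply: contra nsub => /subseq_trans; apply; exact: subseq_rcons.
have := ys; rewrite /= rcons_path => /andP[ys1 ysz].
have yz1 : path (arrow Q) (last y s) [:: z] by rewrite /= ysz.
have c : is_composite (Sub (last y s, [:: z]) yz1 : qpath Q) (Sub (y, s) ys1)
    (Sub (y, rcons s z) ys).
  by rewrite /is_composite /path_target /path_source !SubK /= cats1 !eqxx.
rewrite -(path_vector_mul c); apply: memv_mul; last first.
  rewrite IHw; apply: contra nsub; rewrite /vertices !SubK /=.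
  by rewrite -rcons_cons zx subseq_rcons2 eqxx.
by rewrite path_vector_J -val_eqE /= xpair_eqE andbF.
Qed.

Lemma prodJ_eq u v : reflect (same_paths Q (rev u) (rev v)) (prodJ u == prodJ v).
Proof.
apply: (iffP eqP) => [e [|x s] xs|e].
- by rewrite !sub0seq.
- have := path_vector_prodJ u (Sub (x, s) xs); rewrite e path_vector_prodJ.
  by rewrite /vertices SubK => /negb_inj.
apply/val_inj/vspaceP=> a; rewrite !mem_ideal; apply: eq_forallb => p.
by rewrite !path_vector_prodJ (e (vertices p) (valP p)).
Qed.

Lemma ideal_prodJ (I : ideal A) : admissible Q -> exists w, prodJ w = I.
Proof.
move=> admQ.
(* The paths outside [I], with value [false] on sequences that are not paths; the ideal property
   makes this set closed under subpaths. *)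
pose D x s := oapp (fun p : qpath Q => pv p \notin val I) false (insub (x, s)).
have DP x s (xs : path (arrow Q) x s) : D x s = (pv (Sub (x, s) xs) \notin val I).
  by rewrite /D insubT.
have Dpath x s : D x s -> path (arrow Q) x s.
  by rewrite /D; case: insubP.
have [||w wE] := closed_paths_word admQ Dpath.
- move=> x s t Dst; have xst := Dpath _ _ Dst.
  have := xst; rewrite cat_path => /andP[xs xt].
  move: Dst; rewrite (DP _ _ xs) (DP _ _ xst); apply: contra.
  have c : is_composite (Sub (last x s, t) xt : qpath Q) (Sub (x, s) xs)
      (Sub (x, s ++ t) xst).
    by rewrite /is_composite /path_target /path_source !SubK /= !eqxx.
  by rewrite -(path_vector_mul c); apply: ideal_mull.
- move=> x y s Dys; have xys := Dpath _ _ Dys; case/andP: (xys) => xy ys.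
  have xy1 : path (arrow Q) x [:: y] by rewrite /= xy.
  move: Dys; rewrite (DP _ _ ys) (DP _ _ xys); apply: contra.
  have c : is_composite (Sub (y, s) ys : qpath Q) (Sub (x, [:: y]) xy1)
      (Sub (x, y :: s) xys).
    by rewrite /is_composite /path_target /path_source !SubK /= !eqxx.
  by rewrite -(path_vector_mul c); apply: ideal_mulr.
exists (rev w); apply/val_inj/vspaceP=> a; rewrite !mem_ideal.
apply: eq_forallb => -[[x s] xs]; rewrite path_vector_prodJ revK /vertices /=.
by rewrite -wE // (DP _ _ xs) negbK.
Qed.

End Algebra.

Theorem theorem55 (k : closedFieldType) (n : nat) (Q : oriented_tree n)
    (n_gt1 : (1 < n)%N)
    (Q_admissible : admissible Q)
    (K'_nonempty : inner_sinks_and_sources Q != set0) :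
  presented_by (@J k n Q) (J_relation Q).
Proof.
split=> [I|u v]; first exact: ideal_prodJ.
rewrite -{2}[u]revK -{2}[v]revK.
split=> [/eqP/prodJ_eq/same_paths_rcong //|/rcong_same_paths uv].
by apply/eqP/prodJ_eq.
Qed.
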